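(* Let $n\ge 2$ and let $V=(V_1,\ldots,V_n)$ be a $\mathcal{U}_n$-twisted isometry on a Hilbert space $\mathcal{H}$ with respect to $\{U_{ij}\}_{i<j}$. For each $A\subseteq I_n=\{1,\ldots,n\}$ let $\mathcal{D}_A=\mathcal{D}_A(V)$ be the $A$-wandering subspace of $V$ and let $M_A=(M_{A,1},\ldots,M_{A,n})$ on $H^2_{\mathcal{D}_A}(\mathbb{D}^{|A|})$ be the model operator of $V$ corresponding to $A$. Put $M_{V,i} = \bigoplus_{A\subseteq I_n} M_{A,i}$, $i=1,\ldots,n$. Then $(V_1,\ldots,V_n)$ is unitarily equivalent to $(M_{V,1}, \ldots, M_{V,n})$ on $\bigoplus_{A \subseteq I_n} H^2_{\mathcal{D}_A}(\mathbb{D}^{|A|})$; that is, there is a unitary $\Pi:\mathcal{H}\to\bigoplus_{A \subseteq I_n} H^2_{\mathcal{D}_A}(\mathbb{D}^{|A|})$ with $\Pi V_i = M_{V,i}\Pi$ for all $i=1,\ldots,n$.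
   Context: All Hilbert spaces are complex and separable. $\mathcal{U}_n$-twisted isometry: let $\{U_{ij}\}_{1 \leq i<j\leq n}$ be commuting unitaries on $\mathcal{H}$ and put $U_{ji} := U_{ij}^*$ for $i<j$. An $n$-tuple of isometries $(V_1,\ldots,V_n)$ on $\mathcal{H}$ is a $\mathcal{U}_n$-twisted isometry with respect to $\{U_{ij}\}_{i<j}$ if $V_i^*V_j=U_{ij}^*V_jV_i^*$ and $V_kU_{ij}=U_{ij}V_k$ for all $i,j,k\in\{1,\ldots,n\}$ with $i \neq j$. Wandering subspaces: for $B = \{i_1 < \cdots < i_m\} \subseteq I_n$ and $l \in \mathbb{Z}_+^m$, $V_B^l = V_{i_1}^{l_1}\cdots V_{i_m}^{l_m}$ (and $V_\emptyset^l=I$, with exactly one index $l$). $\mathcal{W}_A = \bigcap_{i\in A}\ker V_i^*$ for $A \neq \emptyset$, $\mathcal{W}_\emptyset = \mathcal{H}$. The $A$-wandering subspace is $\mathcal{D}_A(V) = \bigcap_{l\in\mathbb{Z}_+^{n-|A|}} V_{I_n\setminus A}^l\mathcal{W}_A$ (so $\mathcal{D}_{I_n}=\mathcal{W}_{I_n}$). It is a fact that $\mathcal{D}_A$ reduces $V_j$ for $j\in A^c=I_n\setminus A$ and $U_{st}$ for $s\neq t$. Hardy space notation: for a Hilbert space $\mathcal{E}$ and $m\geq 1$, $H^2_{\mathcal{E}}(\mathbb{D}^m)=H^2(\mathbb{D}^m)\otimes\mathcal{E}$ is the $\mathcal{E}$-valued Hardy space over the polydisc (square summable $\mathcal{E}$-coefficient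 power series $\sum_{k\in\mathbb{Z}_+^m} z^k\eta_k$); $M_{z_i}$ is multiplication by $z_i$. For a unitary $U$ on $\mathcal{E}$ and $1\le j\le m$, $D_j[U]$ is the unitary on $H^2_{\mathcal{E}}(\mathbb{D}^m)$ with $D_j[U](z^k\eta)=z^k(U^{k_j}\eta)$, $k\in\mathbb{Z}_+^m$, $\eta\in\mathcal{E}$. Model operator: for $A=\{p_1<\cdots<p_m\}\neq\emptyset$ with $A^c=\{q_1<\cdots<q_{n-m}\}$, $M_A$ on $H^2_{\mathcal{D}_A}(\mathbb{D}^m)$ is given by $M_{A,p_1}=M_{z_1}$; $M_{A,p_i}=M_{z_i}\big(D_1[U_{p_ip_1}]\cdots D_{i-1}[U_{p_ip_{i-1}}]\big)$ for $1<i\le m$; $M_{A,q_j}=\big(D_1[U_{q_jp_1}]\cdots D_m[U_{q_jp_m}]\big)\big(I_{H^2(\mathbb{D}^m)}\otimes V_{q_j}|_{\mathcal{D}_A}\big)$ for $1\le j\le n-m$, where inside the $D$'s each $U_{st}$ means $U_{st}|_{\mathcal{D}_A}$. For $A=\emptyset$, $H^2_{\mathcal{D}_\emptyset}(\mathbb{D}^{0}) := \mathcal{D}_\emptyset = \bigcap_{k\in\mathbb{Z}_+^n}V^k\mathcal{H}$ and $M_{\emptyset,t}:=V_t|_{\mathcal{D}_\emptyset}$. If $\mathcal{D}_A=\{0\}$ the corresponding summand is $\{0\}$. *)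

(* Defs.v *)
From HB Require Import structures.
From mathcomp Require Import all_boot all_order all_algebra.
From mathcomp Require Import complex.
From mathcomp Require Import boolp classical_sets functions cardinality reals ereal.
From mathcomp Require Import topology normedtype esum.
From mathcomp.analysis.showcase Require summability.

Set Implicit Arguments.
Unset Strict Implicit.
Unset Printing Implicit Defensive.

Import Order.TTheory GRing.Theory Num.Theory.
Import numFieldNormedType.Exports.

Local Open Scope classical_set_scope.
Local Open Scope ring_scope.

(** * Hilbert spaces and operators *)

(* The inner product is linear in the first and conjugate linear in the second
   argument.  Norms over [R[i]] are [R[i]]-valued, with real values. *)
HB.mixin Record CompleteNormedModule_isHilbert (R : realType) H
    of CompleteNormedModule R[i] H := {
  inner : {dot H for (@Num.conj R[i] : R[i] -> R[i])};
  inner_normE : forall x : H, inner x x = `|x| ^+ 2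
}.

#[short(type="hilbertType")]
HB.structure Definition Hilbert (R : realType) :=
  {H of CompleteNormedModule R[i] H & CompleteNormedModule_isHilbert R H}.

Section Operators.
Variables (R : realType) (H : hilbertType R).

Definition separable := exists2 D : set H, countable D & dense D.

(* Such an [S] is unique, and by the Riesz representation theorem it exists
   whenever [T] is bounded and linear; here [T] is always an isometry. *)
Definition adjoint (T : H -> H) : H -> H :=
  get [set S : H -> H | forall x y, inner (T x) y = inner x (S y)].

Definition isometric (T : {linear H -> H}) := forall x, `|T x| = `|x|.

Definition unitary (T : {linear H -> H}) :=
  (forall x y, inner (T x) (T y) = inner x y) /\ range T = setT.

End Operators.

(** * Hardy spaces over the polydisc *)

Definition multiindex (m : nat) := {ffun 'I_m -> nat}.

(* [f : pseries H m] stands for the formal power series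
   \sum_k z^k (f k) in [m] variables with coefficients in [H]. *)
Definition pseries (H : Type) (m : nat) := multiindex m -> H.

Section Hardy.
Variables (R : realType) (H : hilbertType R).

(* The Hardy space with coefficients in a closed subspace [E] of [H].  As there
   is only one multi-index of length 0, for [m = 0] this is [E] itself. *)
Definition hardy (E : set H) (m : nat) : set (pseries H m) :=
  [set f | (forall k, E (f k)) /\
           summable setT (fun k => ((complex.Re `|f k|) ^+ 2)%:E)].

(* An unconditional sum, absolutely convergent if [f] and [g] are in [hardy]. *)
Definition hardy_inner m (f g : pseries H m) : R[i] :=
  summability.sum (fun k => inner (f k) (g k) : R[i]^o).

(* [M_{z_i}]; the subtracted boolean makes the index [k - e_i]. *)
Definition mulz m (i : 'I_m) (f : pseries H m) : pseries H m :=
  fun k => if k i == 0%N then 0 else f [ffun j => (k j - (j == i))%N].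

(* [D_j[T]] *)
Definition diagop m (j : 'I_m) (T : H -> H) (f : pseries H m) : pseries H m :=
  fun k => iter (k j) T (f k).

(* [I_{H^2(D^m)} \otimes T] *)
Definition tensop m (T : H -> H) (f : pseries H m) : pseries H m :=
  fun k => T (f k).

End Hardy.

(** * Twisted isometries, wandering subspaces and model operators *)

Section Model.
Variables (R : realType) (H : hilbertType R) (n : nat).
(* Of [U] only the values [U i j] with [i < j] matter. *)
Variables (U : 'I_n -> 'I_n -> {linear H -> H}) (V : 'I_n -> {linear H -> H}).

Definition twist (i j : 'I_n) : H -> H :=
  if (i < j)%N then (U i j : H -> H) else adjoint (U j i).

Record twisted_isometry : Prop := TwistedIsometry {
  twist_unitary : forall i j : 'I_n, (i < j)%N -> unitary (U i j);
  twist_commute : forall i j k l : 'I_n, (i < j)%N -> (k < l)%N ->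
    U i j \o U k l =1 U k l \o U i j;
  twisted_isometric : forall i, isometric (V i);
  twisted_relation : forall i j, i != j ->
    adjoint (V i) \o V j =1 adjoint (twist i j) \o V j \o adjoint (V i);
  twisted_commute : forall i j k, i != j -> V k \o twist i j =1 twist i j \o V k
}.

(* [V_B^l]: as [enum B] is increasing, [enum_val] enumerates the elements of [B]
   in increasing order; the product is taken in that order. *)
Definition Vpow (B : {set 'I_n}) (l : multiindex #|B|) : H -> H :=
  \big[comp/id]_(j < #|B|) iter (l j) (V (enum_val j)).

Definition wker (A : {set 'I_n}) : set H :=
  \bigcap_(i in [set` A]) [set x | adjoint (V i) x = 0].

Definition wandering (A : {set 'I_n}) : set H :=
  \bigcap_(l in [set: multiindex #|~: A|]) (Vpow l @` wker A).

(* [M_{A,t}] as an operator on all formal power series with coefficients in [H].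
   The first case is [t = p_i], the second [t \notin A].  On [hardy] with
   coefficients in the reducing subspace [wandering A], [twist] and [V] act as
   their restrictions to [wandering A]. *)
Definition model_op (A : {set 'I_n}) (t : 'I_n) :
    pseries H #|A| -> pseries H #|A| :=
  if [pick i : 'I_#|A| | enum_val i == t] is Some i then
    mulz i \o \big[comp/id]_(j < #|A| | (j < i)%N) diagop j (twist t (enum_val j))
  else
    (\big[comp/id]_(j < #|A|) diagop j (twist t (enum_val j))) \o tensop (V t).

Definition model_family := forall A : {set 'I_n}, pseries H #|A|.

(* The direct sum over all [A] of the Hardy spaces with coefficients in
   [wandering A]. *)
Definition model_space : set model_family :=
  [set F | forall A, hardy (wandering A) (F A)].

Definition model_inner (F G : model_family) : R[i] :=
  \sum_(A : {set 'I_n}) hardy_inner (F A) (G A).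

Definition model_sum_op (t : 'I_n) (F : model_family) : model_family :=
  fun A => model_op t (F A).

Definition unitary_onto_model (Pi : H -> model_family) :=
  [/\ forall (a : R[i]) (x y : H) A k,
        Pi (a *: x + y) A k = a *: Pi x A k + Pi y A k,
      forall x y, model_inner (Pi x) (Pi y) = inner x y
    & range Pi = model_space].

End Model.

(* Main.v *)
Require Import Defs.
From mathcomp Require Import all_boot all_order all_algebra finmap.
From mathcomp Require Import complex boolp classical_sets reals topology normedtype.
From mathcomp Require Import functions cardinality fsbigop ereal esum ring lra.
From mathcomp.analysis.showcase Require summability.

Set Implicit Arguments.
Unset Strict Implicit.
Unset Printing Implicit Defensive.

Import Order.TTheory GRing.Theory Num.Theory.
Import numFieldNormedType.Exports.

Local Open Scope classical_set_scope.
Local Open Scope ring_scope.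

(** The theorem is a joint Wold decomposition.  Write [V_i'] for the adjoint of
    [V_i], [U_ij] for the twists, and [P_{i,l} = V_i^l V_i'^l] for the projection
    onto the range of [V_i^l].

    The defining relations imply [V_i V_j = U_ij V_j V_i] ([VV]), and the two
    twists picked up when [V_j] crosses [V_i^l] and [V_i'^l] cancel: for distinct
    [i] and [j], [P_{i,l}] commutes with [V_j] and [V_j'] ([Vproj_V],
    [Vproj_Vs]).  So the Wold decompositions of the single isometries are
    compatible.  A vector has grade [m] for [i] if it lies in [V_i^m (ker V_i')],
    and infinite grade if it lies in the range of every [V_i^l]; to a function
    assigning a grade to each index corresponds the subspace of the vectors with
    these grades.  Different functions give orthogonal subspaces ([grade_orth]),
    and together these subspaces span [H] ([graded_total]).

    A function assigning grades is the same as a pair [(A, k)], where [A] is the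
    set of indices of finite grade and [k] lists these grades ([profile_surj]).
    The wandering subspace [D_A] is the one with grades [0] on [A] and infinite
    outside [A] ([wandering_graded]), and [V_A^k] maps [D_A] isometrically onto the
    subspace of [(A, k)] ([graded_Vpow], [graded_Vpow_ex]).  Therefore [H] is the
    orthogonal sum of copies of the [D_A], and the unitary of the theorem sends [x]
    to the family of [coefficient]s: that of index [(A, k)] is the element [z] of
    [D_A] with [inner z y = inner x (V_A^k y)] for all [y] in [D_A].  It is onto and
    preserves inner products because an orthogonal series with summable squared
    norms converges ([orthogonal_sum_cvg], [model_synthesis]).

    The model operators describe what happens when [V_t] multiplies [V_A^k] from
    the left.  It moves past the factors preceding its place and each crossing
    leaves a power of a twist, which is a diagonal operator of the model.  If
    [t] is in [A] it then raises an exponent, which is multiplication by a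
    variable; otherwise it arrives at [D_A] and acts there ([V_Vprod_in],
    [V_Vprod], [coefficient_V]).

    Adjoints and orthogonal projections are obtained from a single minimisation,
    [least_squares]. *)

(** * Inner products *)

Section HilbertSpace.
Variables (R : realType) (H : hilbertType R).
Implicit Types (x y z : H) (a : R[i]) (S : set H).

Lemma innerDl x y z : inner (x + y) z = inner x z + inner y z.
Proof. exact: linearDl. Qed.

Lemma innerDr x y z : inner x (y + z) = inner x y + inner x z.
Proof. exact: linearDr. Qed.

Lemma innerNl x z : inner (- x) z = - inner x z.
Proof. exact: linearNl. Qed.

Lemma innerNr x z : inner x (- z) = - inner x z.
Proof. exact: linearNr. Qed.

Lemma innerBl x y z : inner (x - y) z = inner x z - inner y z.
Proof. by rewrite innerDl innerNl. Qed.

Lemma innerBr x y z : inner x (y - z) = inner x y - inner x z.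
Proof. by rewrite innerDr innerNr. Qed.

Lemma inner0l z : inner (0 : H) z = 0.
Proof. exact: linear0l. Qed.

Lemma inner0r z : inner z (0 : H) = 0.
Proof. exact: linear0r. Qed.

Lemma innerZl a y z : inner (a *: y) z = a * inner y z.
Proof. exact: linearZl_LR. Qed.

Lemma innerZr a y z : inner y (a *: z) = a^* * inner y z.
Proof. exact: linearZr_LR. Qed.

Lemma innerC x y : inner y x = (inner x y)^*.
Proof. by rewrite hermC expr0 mul1r. Qed.

Lemma inner_suml (I : Type) (r : seq I) (F : I -> H) z :
  inner (\sum_(i <- r) F i) z = \sum_(i <- r) inner (F i) z.
Proof. by elim/big_rec2: _ => [|i u v _ <-]; rewrite ?inner0l ?innerDl. Qed.

Lemma inner_sumr (I : Type) (r : seq I) (F : I -> H) z :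
  inner z (\sum_(i <- r) F i) = \sum_(i <- r) inner z (F i).
Proof. by elim/big_rec2: _ => [|i u v _ <-]; rewrite ?inner0r ?innerDr. Qed.

Definition sqnorm x : R := complex.Re (inner x x).

Lemma inner_sqnorm x : inner x x = (sqnorm x)%:C%C.
Proof. by rewrite RRe_real// realE dnorm_ge0. Qed.

Lemma sqnormE x : sqnorm x = complex.Re `|x| ^+ 2.
Proof.
have /RRe_real xE : `|x| \is Num.real by rewrite realE normr_ge0.
apply: complexI; rewrite -inner_sqnorm inner_normE -{1}xE.
by rewrite expr2 -!rmorphM.
Qed.

Lemma sqnorm_ge0 x : 0 <= sqnorm x.
Proof. by rewrite sqnormE sqr_ge0. Qed.

Lemma sqnorm_eq0 x : sqnorm x = 0 -> x = 0.
Proof.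
move=> x0; apply/eqP; rewrite -normr_eq0 -sqrf_eq0 -inner_normE inner_sqnorm.
by rewrite x0.
Qed.

Lemma inner_eq0 x : inner x x = 0 -> x = 0.
Proof. by move=> x0; apply: sqnorm_eq0; rewrite /sqnorm x0. Qed.

Lemma inner_inj x y : (forall z, inner x z = inner y z) -> x = y.
Proof.
by move=> xy; apply/eqP; rewrite -subr_eq0; apply/eqP/inner_eq0; rewrite innerBl xy subrr.
Qed.

Lemma Re_conj (a : R[i]) : complex.Re a^* = complex.Re a.
Proof. by case: a. Qed.

Lemma sqnormD x y :
  sqnorm (x + y) = sqnorm x + sqnorm y + 2 * complex.Re (inner x y).
Proof.
rewrite /sqnorm innerDl !innerDr !raddfD/= (innerC x y) Re_conj.
by ring.
Qed.

Lemma sqnormN x : sqnorm (- x) = sqnorm x.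
Proof. by rewrite /sqnorm innerNl innerNr opprK. Qed.

Lemma sqnormB x y :
  sqnorm (x - y) = sqnorm x + sqnorm y - 2 * complex.Re (inner x y).
Proof. by rewrite sqnormD sqnormN innerNr raddfN/= mulrN. Qed.

Lemma sqnormBC x y : sqnorm (x - y) = sqnorm (y - x).
Proof. by rewrite -sqnormN opprB. Qed.

Lemma parallelogram x y :
  sqnorm (x + y) + sqnorm (x - y) = 2 * sqnorm x + 2 * sqnorm y.
Proof. by rewrite sqnormD sqnormB; ring. Qed.

Lemma sqnormD_le x y : sqnorm (x + y) <= 2 * sqnorm x + 2 * sqnorm y.
Proof. by rewrite -parallelogram lerDl sqnorm_ge0. Qed.

(** If subtracting a multiple of [e] cannot make the squared norm of [v] smaller
    than [d], then [inner v e] is small: this is the first order condition at an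
    approximate minimum.  For [d = 0] it is a weak form of the Cauchy-Schwarz
    inequality, and it is in this form that continuity of the inner product is
    proved. *)
Lemma inner_sqr_le (d : R) v e :
  (forall t : R[i], d <= sqnorm (v - t *: e)) ->
  complex.Re (inner v e) ^+ 2 + complex.Im (inner v e) ^+ 2
  <= (sqnorm v - d) * (1 + sqnorm e).
Proof.
move=> dP; set z := inner v e; set q := (_ + _).
have e0 := sqnorm_ge0 e.
pose s := (1 + sqnorm e)^-1.
have q0 : 0 <= q by rewrite addr_ge0// sqr_ge0.
have qE : z * z^* = q%:C%C by rewrite -normCK -add_Re2_Im2.
have s0 : 0 < s by rewrite invr_gt0; lra.
have sE : s * (1 + sqnorm e) = 1 by rewrite mulVf//; lra.
(* The minimum is at t = z / sqnorm e; the denominator 1 + sqnorm e costs a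
   constant only, and covers e = 0. *)
have := dP (s%:C%C * z).
rewrite sqnormB innerZr rmorphM/= -/z.
have -> : ((s%:C%C)^* = s%:C%C :> R[i]) by rewrite conj_Creal// complex_real.
rewrite -mulrA (mulrC z^*) qE -rmorphM /=.
have -> : sqnorm ((s%:C%C * z) *: e) = s ^+ 2 * q * sqnorm e.
  apply: complexI; rewrite -inner_sqnorm innerZl innerZr inner_sqnorm.
  rewrite rmorphM/= conj_Creal ?complex_real// !rmorphM/= -qE.
  by ring.
have : s * q * (1 - s * sqnorm e) >= 0.
  by rewrite mulr_ge0// ?mulr_ge0 ?(ltW s0)//; nra.
move=> h1 h2.
have : s * q <= sqnorm v - d by nra.
move=> h3; have : s * q * (1 + sqnorm e) <= (sqnorm v - d) * (1 + sqnorm e).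
  by rewrite ler_wpM2r//; lra.
by rewrite mulrAC sE mul1r.
Qed.

End HilbertSpace.

(** * Completeness and least squares *)

Section Completeness.
Variables (R : realType) (H : hilbertType R).
Implicit Types (x y z : H) (S : set H).

Lemma normc_lt (z : R[i]) (e : R) : 0 < e ->
  (`|z| < e%:C%C) = (complex.Re z ^+ 2 + complex.Im z ^+ 2 < e ^+ 2).
Proof.
move=> e0; rewrite -(@ltr_pXn2r _ 2)// ?nnegrE ?normr_ge0 ?ler0c ?ltW//.
by rewrite -add_Re2_Im2 -rmorphXn/= ltcR.
Qed.

Lemma norm_lt x (e : R) : 0 < e -> (`|x| < e%:C%C) = (sqnorm x < e ^+ 2).
Proof.
move=> e0; rewrite -(@ltr_pXn2r _ 2)// ?nnegrE ?normr_ge0 ?ler0c ?ltW//.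
by rewrite -inner_normE inner_sqnorm -rmorphXn/= ltcR.
Qed.

Lemma gt0_complexE (e : R[i]) : 0 < e -> exists2 r : R, 0 < r & e = r%:C%C.
Proof.
move=> e0; exists (complex.Re e); last by rewrite RRe_real// gtr0_real.
by move: e0; rewrite ltcE => /andP[].
Qed.

(** Completeness in terms of the real-valued squared norm.  It serves both for
    minimising families and for nets of finite sums, whence the general filter. *)
Lemma sqnorm_cauchy_cvg (T : Type) (F : set_system T) {FF : ProperFilter F}
    (u : T -> H) :
  (forall e : R, 0 < e ->
     exists2 A, F A & forall s t, A s -> A t -> sqnorm (u s - u t) < e) ->
  cvg (u @ F).
Proof.
move=> uP; apply: cauchy_cvg; apply: cauchy_exP => _ /gt0_complexE[e e0 ->].
have [A FA AP] := uP (e ^+ 2) (exprn_gt0 2 e0).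
have [s As] := filter_ex FA.
exists (u s); apply: (@filterS _ F _ A _ _ FA) => t At /=.
by rewrite -ball_normE /= norm_lt//; exact: AP.
Qed.

Lemma inner_cvg (T : Type) (F : set_system T) {FF : Filter F} (u : T -> H) l y :
  u @ F --> l -> (inner (u t) y : R[i]^o) @[t --> F] --> (inner l y : R[i]^o).
Proof.
move=> ul; apply/cvgrPdist_lt => _ /gt0_complexE[e e0 ->].
have y0 := sqnorm_ge0 y; set c := 1 + sqnorm y.
have c0 : 0 < c by rewrite /c; lra.
have d0 : 0 < e / c by rewrite divr_gt0.
have : 0 < (e / c)%:C%C :> R[i] by rewrite ltcR.
move/cvgrPdist_lt : ul => /[apply]; apply: filterS => t /=.
rewrite norm_lt// -innerBl normc_lt// => ut.
apply: le_lt_trans (inner_sqr_le _) _; first by move=> a; exact: sqnorm_ge0.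
rewrite subr0 -/c; apply: lt_le_trans (_ : (e / c) ^+ 2 * c <= _).
  by rewrite ltr_pM2r.
have -> : (e / c) ^+ 2 * c = e ^+ 2 / c by field; rewrite gt_eqF.
by rewrite ler_pdivrMr// ler_peMr ?sqr_ge0// /c lerDl.
Qed.

Lemma limC_unique (T : Type) (F : set_system T) {FF : ProperFilter F}
    (g : T -> R[i]^o) (a b : R[i]) :
  g @ F --> (a : R[i]^o) -> g @ F --> (b : R[i]^o) -> a = b.
Proof.
by move=> ga gb; exact: (cvg_unique (@norm_hausdorff _ R[i]^o) ga gb).
Qed.

(** Every closed subspace used below is the orthogonal complement of some set;
    it is then closed under limits because the inner product is continuous. *)
Definition orth S : set H := [set x | forall y, S y -> inner x y = 0].

Lemma orth_lin S a x y : orth S x -> orth S y -> orth S (a *: x + y).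
Proof. by move=> Sx Sy z Sz; rewrite innerDl innerZl Sx// Sy// mulr0 addr0. Qed.

Lemma orth_cvg S (T : Type) (F : set_system T) {FF : ProperFilter F} (u : T -> H) l :
  u @ F --> l -> F [set t | orth S (u t)] -> orth S l.
Proof.
move=> ul FS y Sy; apply: (limC_unique (inner_cvg (y := y) ul)).
apply: cvg_near_cst; apply: filterS FS => t; exact.
Qed.

(** Polarization: squared norms determine the real part of the inner product,
    and replacing [y] by [i y] gives the imaginary part. *)
Lemma isometric_inner (T : {linear H -> H}) x y :
  isometric T -> inner (T x) (T y) = inner x y.
Proof.
move=> Tisom; have sqnormT v : sqnorm (T v) = sqnorm v by rewrite !sqnormE Tisom.
have ReT v w : complex.Re (inner (T v) (T w)) = complex.Re (inner v w).
  by have := sqnormT (v + w); rewrite linearD !sqnormD !sqnormT; lra.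
have := ReT x ('i%C *: y); rewrite linearZ !innerZr.
have := ReT x y.
case: (inner _ _) (inner _ _) => [a b] [c d] /= -> h; congr (_ +i* _)%C.
move: h; lra.
Qed.

(** The best approximation of [y] by vectors [T s] with [s] in a closed subspace.
    With [T] the identity this is orthogonal projection; with the whole space as
    subspace the normal equations say that [s] is the value at [y] of the adjoint
    of [T].  The points [x] at which [sqnorm (y - T x)] is close to its infimum [d]
    form a Cauchy filter, by the parallelogram law applied to [y - T x] and
    [y - T x']: the midpoint of [x] and [x'] cannot do better than [d]. *)
Lemma least_squares (T : {linear H -> H}) S y : isometric T ->
  exists2 s, orth S s & forall e, orth S e -> inner (y - T s) (T e) = 0.
Proof.
move=> Tisom.
have sqnormT x : sqnorm (T x) = sqnorm x by rewrite !sqnormE Tisom.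
pose D := [set sqnorm (y - T x) | x in orth S].
have oS0 : orth S 0 by move=> z _; rewrite inner0l.
have Dinf : has_inf D.
  by split; [exists (sqnorm (y - T 0)), 0|exists 0 => _ [x _ <-]; exact: sqnorm_ge0].
pose d := inf D.
have dle x : orth S x -> d <= sqnorm (y - T x).
  by move=> Sx; apply: ge_inf; [exact: Dinf.2|exists x].
pose near (e : R) := [set x | orth S x /\ sqnorm (y - T x) < d + e].
pose F := filter_from [set e : R | 0 < e] near.
have FF : ProperFilter F.
  apply: filter_from_proper => [|e e0]; last first.
    by have [_ [x Sx <-] xd] := inf_adherent e0 Dinf; exists x.
  apply: filter_from_filter; first by exists 1; exact: ltr01.
  move=> e e' e0 e'0; exists (Num.min e e'); first by rewrite /= lt_min; apply/andP.
  move=> x [Sx]; rewrite /near -lterBDl lt_min => /andP[h h'].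
  by split; split=> //; lra.
have Fcvg : cvg (id @ F).
  apply: sqnorm_cauchy_cvg => e e0.
  exists (near (e / 8)); first by exists (e / 8) => //=; lra.
  move=> x x' [Sx xd] [Sx' x'd].
  have half : 2^-1 + 2^-1 = 1 :> R[i] by field.
  have mid : d <= sqnorm (y - T (2^-1 *: x + 2^-1 *: x')).
    by apply/dle/orth_lin => //; rewrite -[_ *: _]addr0; exact: orth_lin.
  have := parallelogram (y - T x) (y - T x').
  have -> : y - T x - (y - T x') = T (x' - x).
    by rewrite (linearB T) opprB addrC addrA subrK.
  have -> : y - T x + (y - T x') =
      (y - T (2^-1 *: x + 2^-1 *: x')) + (y - T (2^-1 *: x + 2^-1 *: x')).
    rewrite [RHS]addrACA [LHS]addrACA -!opprD; congr (_ - _).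
    by rewrite -!(linearD T) addrACA -!scalerDl half !scale1r.
  rewrite sqnormT (sqnormBC x') sqnormD -/(sqnorm _).
  by lra.
have /cvg_ex[s Fs] := Fcvg.
exists s; first by apply: (orth_cvg Fs); exists 1; [exact: ltr01|move=> x []].
move=> e Se; pose g u : R[i]^o := inner (y - T u) (T e).
have g_lim : g u @[u --> F] --> (inner (y - T s) (T e) : R[i]^o).
  have -> : g = fun u => inner y (T e) - inner u e.
    by apply/funext => u; rewrite /g innerBl isometric_inner.
  by rewrite innerBl isometric_inner//; apply: cvgB; [exact: cvg_cst|exact: inner_cvg].
(* Near the minimum the residual is almost orthogonal to the range of T. *)
have g_0 : g u @[u --> F] --> (0 : R[i]^o).
  apply/cvgr0Pnorm_lt => _ /gt0_complexE[r r0 ->].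
  have e0 := sqnorm_ge0 e.
  pose c := 1 + sqnorm e; have c0 : 0 < c by rewrite /c; lra.
  exists (r ^+ 2 / c); first by rewrite /= divr_gt0// exprn_gt0.
  move=> u [Su ud] /=; rewrite normc_lt//.
  apply: le_lt_trans (inner_sqr_le (d := d) _) _.
    move=> t; rewrite -addrA -opprD -linearZ -linearD; apply: dle.
    by rewrite addrC; exact: orth_lin.
  by rewrite sqnormT -ltr_pdivlMr// ltrBlDl.
exact: (limC_unique g_lim g_0).
Qed.

End Completeness.

(** * Adjoints and unitary maps *)

Section Adjoints.
Variables (R : realType) (H : hilbertType R).
Implicit Types (x y z : H) (S : set H).

Lemma orth_projection S y :
  exists2 s, orth S s & forall e, orth S e -> inner y e = inner s e.
Proof.
have [//|s Ss sP] := @least_squares R H idfun S y.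
by exists s => // e /sP; rewrite innerBl => /eqP; rewrite subr_eq0 => /eqP.
Qed.

(** The equality case of the Cauchy-Schwarz inequality. *)
Lemma inner_eq x y : inner x y = inner x x -> inner y y = inner x x -> x = y.
Proof.
move=> xy yy; apply/eqP; rewrite -subr_eq0; apply/eqP/sqnorm_eq0.
by rewrite sqnormB /sqnorm xy yy; ring.
Qed.

Lemma adjointE (T S : H -> H) :
  (forall x y, inner (T x) y = inner x (S y)) ->
  forall x y, inner (T x) y = inner x (adjoint T y).
Proof.
by move=> TS; apply: (@getPex _ [set S | forall x y, inner (T x) y = inner x (S y)]); exists S.
Qed.

Lemma isometric_adjointE (T : {linear H -> H}) x y :
  isometric T -> inner (T x) y = inner x (adjoint T y).
Proof.
move=> Tisom.
have [S SP] : exists S : H -> H, forall y x, inner (T x) y = inner x (S y).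
  suff /choice[S SP] : forall z, exists s, forall v, inner (T v) z = inner v s by exists S.
  move=> z; have [s _ sP] := least_squares set0 z Tisom.
  exists s => v; apply/eqP; rewrite -subr_eq0 innerC -(isometric_inner v s Tisom).
  by rewrite -conjC0 -(sP v)// innerBl rmorphB/= -!innerC.
by apply: (@adjointE T S) => v w.
Qed.

(** The twist by [(i, j)] with [j < i] is an adjoint, hence a mere function; so
    unitarity is stated for functions. *)
Definition unitary_map (T : H -> H) :=
  (forall x y, inner (T x) (T y) = inner x y) /\ forall y, exists x, T x = y.

Lemma unitary_mapP (T : {linear H -> H}) : unitary T -> unitary_map T.
Proof.
move=> [Tinner TT]; split=> // y.
have : range T y by rewrite TT.
by case=> x _ xy; exists x.
Qed.

Lemma unitary_map_inj (T : H -> H) : unitary_map T -> injective T.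
Proof.
by move=> [TT _] x y xy; apply: inner_inj => z; rewrite -TT xy TT.
Qed.

Lemma unitary_map0 (T : H -> H) : unitary_map T -> T 0 = 0.
Proof. by move=> [TT _]; apply: inner_eq0; rewrite TT inner0l. Qed.

Lemma unitary_map_adjointK (T : H -> H) x : unitary_map T -> T (adjoint T x) = x.
Proof.
move=> [TT /choice[S SK]]; apply: inner_inj => y.
have TP := @adjointE T S; rewrite -[y]SK TT innerC -TP -?innerC//.
by move=> v w; rewrite -{1}[w]SK TT.
Qed.

Lemma unitary_map_adjoint (T : H -> H) : unitary_map T -> unitary_map (adjoint T).
Proof.
move=> uT; have TK x := unitary_map_adjointK x uT; split=> [x y|y].
  by rewrite -uT.1 !TK.
by exists (T y); apply: (unitary_map_inj uT); rewrite TK.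
Qed.

End Adjoints.

(** * Commutation relations *)

Section Twisted.
Variables (R : realType) (H : hilbertType R) (n : nat).
Variables (U : 'I_n -> 'I_n -> {linear H -> H}) (V : 'I_n -> {linear H -> H}).
Hypothesis twV : twisted_isometry U V.
Implicit Types (x y z : H) (t : 'I_n) (A : {set 'I_n}).

Local Notation Vs i := (adjoint (V i)).
Local Notation W := (twist U).

Lemma innerV i x y : inner (V i x) y = inner x (Vs i y).
Proof. by rewrite isometric_adjointE//; exact: (twisted_isometric twV i). Qed.

Lemma innerVs i x y : inner (Vs i x) y = inner x (V i y).
Proof. by rewrite innerC -innerV -innerC. Qed.

Lemma innerVV i x y : inner (V i x) (V i y) = inner x y.
Proof. by rewrite isometric_inner//; exact: (twisted_isometric twV i). Qed.

Lemma VK i : cancel (V i) (Vs i).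
Proof. by move=> x; apply: inner_inj => y; rewrite innerVs innerVV. Qed.

Lemma VsB i x y : Vs i (x - y) = Vs i x - Vs i y.
Proof. by apply: inner_inj => z; rewrite innerBl !innerVs innerBl. Qed.

Lemma Vs0 i : Vs i 0 = 0.
Proof. by rewrite -(subrr 0) VsB !subrr. Qed.

(** The unitaries commuting with all [V i] and their adjoints; products of powers
    of twists belong to this monoid. *)
Definition commutant (T : H -> H) :=
  [/\ unitary_map T, forall i x, T (V i x) = V i (T x)
    & forall i x, T (Vs i x) = Vs i (T x)].

(** The inverse of [T] is its adjoint and commutes with the [V i] as well, so the
    adjoints of the [V i] commute with [T]. *)
Lemma unitary_commutant T :
  unitary_map T -> (forall i x, T (V i x) = V i (T x)) -> commutant T.
Proof.
move=> uT TV; split=> // i x; apply: inner_inj => y.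
have [z <-] := uT.2 y.
by rewrite uT.1 !innerVs -TV uT.1.
Qed.

Lemma commutant_id : commutant id.
Proof. by apply: unitary_commutant => //; split=> // y; exists y. Qed.

Lemma commutant_comp S T : commutant S -> commutant T -> commutant (S \o T).
Proof.
move=> [[SS SO] SV SVs] [[TT TO] TV TVs]; split.
- split=> [x y|y]; first by rewrite /= SS.
  by have [z <-] := SO y; have [x <-] := TO z; exists x.
- by move=> i x /=; rewrite TV SV.
- by move=> i x /=; rewrite TVs SVs.
Qed.

Lemma commutant_iter T k : commutant T -> commutant (iter k T).
Proof.
move=> cT; elim: k => [|k IH]; first exact: commutant_id.
exact: commutant_comp cT IH.
Qed.

Lemma commutant_iterV T i k x : commutant T -> T (iter k (V i) x) = iter k (V i) (T x).
Proof. by move=> [_ TV _]; elim: k => //= k <-. Qed.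

Lemma commutant_iterVs T i k x : commutant T -> T (iter k (Vs i) x) = iter k (Vs i) (T x).
Proof. by move=> [_ _ TV]; elim: k => //= k <-. Qed.

Lemma twist_unitary_map i j : i != j -> unitary_map (W i j).
Proof.
move=> ij; rewrite /twist; case: ifPn => [ltij|].
  by apply: unitary_mapP; exact: (twist_unitary twV).
rewrite -leqNgt leq_eqVlt => /orP[/eqP/val_inj ji|ltji].
  by rewrite ji eqxx in ij.
by apply: unitary_map_adjoint; apply: unitary_mapP; exact: (twist_unitary twV).
Qed.

Lemma twist_commutant i j : i != j -> commutant (W i j).
Proof.
move=> ij; apply: unitary_commutant; first exact: twist_unitary_map.
by move=> k x; have /(_ x) := twisted_commute twV k ij.
Qed.

Lemma VsV i j x : i != j -> W i j (Vs i (V j x)) = V j (Vs i x).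
Proof.
move=> ij; have /(_ x) /= -> := twisted_relation twV ij.
by rewrite unitary_map_adjointK//; exact: twist_unitary_map.
Qed.

(** The relation assumed for a twisted isometry involves one adjoint; this is the
    relation without adjoints that it entails.  Both sides have the norm of [x],
    and by the assumed relation their inner product is [inner x x]: they are equal. *)
Lemma VV i j x : i != j -> V i (V j x) = W i j (V j (V i x)).
Proof.
move=> ij; have [[WW _] WV WVs] := twist_commutant ij.
by apply: inner_eq; rewrite ?WW !innerVV// innerV -WVs VsV// VK innerVV.
Qed.

Lemma VV_iter i j k x : i != j ->
  V i (iter k (V j) x) = iter k (W i j) (iter k (V j) (V i x)).
Proof.
move=> ij; have cW := twist_commutant ij; elim: k => //= k IH.
rewrite VV// IH; congr W.
by case: (commutant_iter k cW) => _ -> _.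
Qed.

Lemma inner_iterV i k x y : inner x (iter k (V i) y) = inner (iter k (Vs i) x) y.
Proof. by elim: k x => // k IH x; rewrite iterS -innerVs IH -iterSr. Qed.

(** The orthogonal projection onto the range of [V_i^l]. *)
Definition Vproj i l x := iter l (V i) (iter l (Vs i) x).

Lemma VprojS i l x : Vproj i l.+1 x = V i (Vproj i l (Vs i x)).
Proof. by rewrite /Vproj iterS iterSr. Qed.

Lemma inner_Vproj i l x y : inner (Vproj i l x) y = inner x (Vproj i l y).
Proof.
elim: l x y => // l IH x y.
by rewrite !VprojS innerV IH innerVs.
Qed.

Lemma VprojB i l x y : Vproj i l (x - y) = Vproj i l x - Vproj i l y.
Proof. by apply: inner_inj => z; rewrite innerBl !inner_Vproj innerBl. Qed.

Lemma Vproj_0 i l : Vproj i l 0 = 0.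
Proof. by rewrite -(subrr 0) VprojB !subrr. Qed.

Lemma commutant_Vproj T i l x : commutant T -> T (Vproj i l x) = Vproj i l (T x).
Proof. by move=> cT; rewrite /Vproj commutant_iterV// commutant_iterVs. Qed.

(** Although [V_i] and [V_j] commute only up to a twist, the range projections of
    [V_i] commute with [V_j] exactly: [V_i] and its adjoint contribute inverse
    twists, which cancel. *)
Lemma Vproj_V i j l x : i != j -> Vproj i l (V j x) = V j (Vproj i l x).
Proof.
move=> ij; have cW := twist_commutant ij; have [uW WV _] := cW.
elim: l x => // l IH x; apply: (unitary_map_inj uW).
by rewrite !VprojS WV commutant_Vproj// VsV// IH VV.
Qed.

Lemma Vproj_Vs i j l x : i != j -> Vproj i l (Vs j x) = Vs j (Vproj i l x).
Proof.
move=> ij; apply: inner_inj => z.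
by rewrite inner_Vproj !innerVs -Vproj_V// inner_Vproj.
Qed.

Lemma Vproj_SV i l x : Vproj i l.+1 (V i x) = V i (Vproj i l x).
Proof. by rewrite VprojS VK. Qed.

Lemma VsVK i k z : iter k (Vs i) (iter k (V i) z) = z.
Proof. by elim: k z => // k IH z; rewrite iterSr /= VK IH. Qed.

Lemma Vproj_idem i l m x : Vproj i l (Vproj i m x) = Vproj i (maxn l m) x.
Proof.
wlog lm : l m x / (l <= m)%N => [hw|].
  have /orP[lm|ml] := leq_total l m; first exact: hw.
  by apply: inner_inj => z; rewrite !inner_Vproj hw// maxnC.
by rewrite (maxn_idPr lm) /Vproj -(subnKC lm) (iterD l (m - l) (V i)) VsVK.
Qed.

(** * Grades with respect to one isometry *)

(** A grade is an element of [nat] with infinity, encoded as [option nat]. *)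
Definition below (k : option nat) l := if k is Some m then (l <= m)%N else true.

(** The Wold decomposition of the single isometry [V_i]: the grade [Some m] is
    [V_i^m] applied to the kernel of the adjoint, and [None] is the unitary part,
    the intersection of all ranges of powers.  Describing both by the eigenvalues
    of the projections [Vproj i l] makes invariance under an operator a
    consequence of its commuting with these projections. *)
Definition grade i (k : option nat) : set H :=
  [set x | forall l, Vproj i l x = if below k l then x else 0].

Definition shift (k : option nat) m := omap (addn^~ m) k.

Lemma grade_orth i k k' x y : k != k' -> grade i k x -> grade i k' y -> inner x y = 0.
Proof.
move=> kk' xk yk'.
have [l kl] : exists l, below k l != below k' l.
  case: k k' kk' {xk yk'} => [m|] [m'|]//= mm'.
  - have /orP[h|h] : (m < m')%N || (m' < m)%N by rewrite -neq_ltn.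
    + by exists m'; rewrite leqnn leqNgt h.
    + by exists m; rewrite leqnn [(m <= m')%N]leqNgt h.
  - by exists m.+1; rewrite ltnn.
  - by exists m'.+1; rewrite ltnn.
have := inner_Vproj i l x y; rewrite xk yk'.
by case: below kl; case: below => // _; rewrite ?inner0l ?inner0r.
Qed.

Lemma grade_V i j k x : i != j -> grade i k x -> grade i k (V j x).
Proof.
by move=> ij xk l; rewrite Vproj_V// xk; case: below; rewrite // linear0.
Qed.

Lemma grade_Vs i j k x : i != j -> grade i k x -> grade i k (Vs j x).
Proof.
by move=> ij xk l; rewrite Vproj_Vs// xk; case: below; rewrite // Vs0.
Qed.

Lemma grade_Vproj i j k l x : i != j -> grade i k x -> grade i k (Vproj j l x).
Proof.
move=> ij; elim: l x => // l IH x xk; rewrite VprojS.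
by apply/grade_V => //; apply/IH/grade_Vs.
Qed.

Lemma grade_commutant T i k x : commutant T -> grade i k (T x) <-> grade i k x.
Proof.
move=> cT; have [uT _ _] := cT.
split=> xk l; last first.
  by rewrite -commutant_Vproj// xk; case: below; rewrite // unitary_map0.
apply: (unitary_map_inj uT); rewrite commutant_Vproj// xk.
by case: below; rewrite // unitary_map0.
Qed.

Lemma grade_shift i k x : grade i k x -> grade i (shift k 1) (V i x).
Proof.
move=> xk [|l]; first by case: k xk => [m|] xk.
rewrite Vproj_SV xk; case: k {xk} => [m|]//=.
by rewrite addn1 ltnS; case: ifP => // _; rewrite linear0.
Qed.

Lemma grade_unshift i k x : grade i (shift k 1) x ->
  V i (Vs i x) = x /\ grade i k (Vs i x).
Proof.
move=> xk; have VVs : V i (Vs i x) = x.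
  by have := xk 1%N; rewrite VprojS; case: k {xk} => [m|]//=; rewrite addn1.
split=> // l; apply: (can_inj (@VK i)); rewrite -VprojS xk.
case: k {xk} => [m|]//=; rewrite addn1 ltnS.
by case: ifP; rewrite ?linear0.
Qed.

Lemma grade_shift_iter i k m x : grade i k x -> grade i (shift k m) (iter m (V i) x).
Proof.
move=> xk; elim: m => [|m IH] /=; first by case: k xk => //= a; rewrite addn0.
by have := grade_shift IH; case: k {xk IH} => //= a; rewrite addn1 addnS.
Qed.

Lemma grade_unshift_iter i k m x : grade i (shift k m) x ->
  iter m (V i) (iter m (Vs i) x) = x /\ grade i k (iter m (Vs i) x).
Proof.
move=> xk; split.
  by have := xk m; case: k {xk} => //= a; rewrite leq_addl.
elim: m x xk => [|m IH] x xk /=; first by case: k xk => //= a; rewrite addn0.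
rewrite -iterS iterSr; apply/IH/(grade_unshift _).2.
by case: k xk {IH} => //= a; rewrite addn1 addnS.
Qed.

Lemma grade0 i x : grade i (Some 0%N) x <-> Vs i x = 0.
Proof.
split=> [xk|x0 [|l]]//; last by rewrite VprojS x0 Vproj_0 linear0.
by have := xk 1%N; rewrite /= -[RHS](linear0 (V i)); exact: (can_inj (@VK i)).
Qed.

Lemma grade_diff i k x : grade i (Some k) (Vproj i k x - Vproj i k.+1 x).
Proof.
move=> l; rewrite VprojB !Vproj_idem /=; case: leqP => kl.
  by rewrite (maxn_idPr (leqW kl)).
by rewrite (maxn_idPl kl) subrr.
Qed.

Lemma shift0 k : shift k 0 = k.
Proof. by case: k => //= c; rewrite addn0. Qed.

Lemma shiftD k a b : shift (shift k a) b = shift k (a + b).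
Proof. by case: k => //= c; rewrite addnA. Qed.

(** * Joint grades *)

Definition graded (k : 'I_n -> option nat) : set H :=
  [set x | forall i, grade i (k i) x].

Lemma eq_graded k k' x : k =1 k' -> graded k x -> graded k' x.
Proof. by move=> kk' xk i; rewrite -kk'. Qed.

(** The joint Wold decomposition is complete.  Take [x] nonzero and orthogonal to
    all joint grades.  For one index [i], either some component
    [Vproj i l x - Vproj i l.+1 x] is nonzero, or [x] is fixed by all [Vproj i l]
    and has grade [None]; so [x] can be replaced by a nonzero vector with a grade
    for [i].  The replacement keeps [x] orthogonal to the joint grades and keeps
    the grades for other indices, since projections of different indices commute.
    After all indices are treated, [x] is orthogonal to itself. *)
Lemma graded_total x : (forall k y, graded k y -> inner x y = 0) -> x = 0.
Proof.
move=> x_orth; apply/eqP/negP => /negP x0.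
have refine (s : seq 'I_n) : exists k z,
    [/\ z != 0, forall i, i \in s -> grade i (k i) z &
        forall k y, graded k y -> inner z y = 0].
  elim: s => [|i s [k [z [z0 zk z_orth]]]]; first by exists (fun=> None), x.
  have [is_|is_] := boolP (i \in s).
    by exists k, z; split=> // j; rewrite inE => /predU1P[->|]; exact: zk.
  (* One more index is given a grade, the other ones keep theirs. *)
  have upd m w : (forall j, j \in s -> grade j (k j) w) -> grade i m w ->
      forall j, j \in i :: s -> grade j (if j == i then m else k j) w.
    move=> wk wm j; rewrite inE; case: eqP => [->//|_ /=]; exact: wk.
  have [[l zl]|zP] := pselect (exists l, Vproj i l z - Vproj i l.+1 z != 0).
    exists (fun j => if j == i then Some l else k j), (Vproj i l z - Vproj i l.+1 z).
    split=> //.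
      apply: upd; last exact: grade_diff.
      move=> j js; have ji : j != i by apply: contraNneq is_ => <-.
      move=> m; rewrite VprojB !(grade_Vproj _ ji (zk j js)).
      by case: below; rewrite // subr0.
    move=> k' y yk'; rewrite innerBl !inner_Vproj.
    have zy := z_orth _ _ yk'.
    by rewrite !yk'; case: below; case: below; rewrite ?zy ?inner0r subrr.
  exists (fun j => if j == i then None else k j), z; split=> //.
  apply: upd => // m /=; elim: m => // m IH.
  apply/eqP; rewrite -{2}IH eq_sym -subr_eq0; apply/negPn/negP => h.
  by apply: zP; exists m.
have [k [z [z0 zk z_orth]]] := refine (enum 'I_n).
have /inner_eq0 : inner z z = 0.
  by apply: (z_orth k) => i; apply: zk; rewrite mem_enum.
by move/eqP; apply/negP.
Qed.

(** * Products of powers of the isometries *)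

Section Products.
Variables (m : nat) (e : 'I_m -> 'I_n).
Implicit Types (l : 'I_m -> nat) (r : seq 'I_m) (k : 'I_n -> option nat).

Definition Vprod l r : H -> H := \big[comp/id]_(j <- r) iter (l j) (V (e j)).

Definition twist_prod t l (P : pred 'I_m) r : H -> H :=
  \big[comp/id]_(j <- r | P j) iter (l j) (W t (e j)).

Lemma Vprod_cons l j r x : Vprod l (j :: r) x = iter (l j) (V (e j)) (Vprod l r x).
Proof. by rewrite /Vprod big_cons. Qed.

Lemma Vprod_nil l x : Vprod l [::] x = x.
Proof. by rewrite /Vprod big_nil. Qed.

Lemma twist_prod_cons t l P j r x :
  twist_prod t l P (j :: r) x =
  if P j then iter (l j) (W t (e j)) (twist_prod t l P r x) else twist_prod t l P r x.
Proof. by rewrite /twist_prod big_cons; case: ifP. Qed.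

Lemma twist_prod_commutant t l (P : pred 'I_m) r :
  (forall j, j \in r -> P j -> e j != t) -> commutant (twist_prod t l P r).
Proof.
move=> Pt; rewrite /twist_prod big_seq_cond.
apply: big_ind => [||j /andP[jr /(Pt _ jr) jt]]; first exact: commutant_id.
  exact: commutant_comp.
by apply/commutant_iter/twist_commutant; rewrite eq_sym.
Qed.

(** The exponent of [V i] in [Vprod l r]. *)
Definition total_degree l r i := (\sum_(j <- r | e j == i) l j)%N.

Lemma graded_iterV k i a x : graded k x ->
  graded (fun j => shift (k j) (if i == j then a else 0%N)) (iter a (V i) x).
Proof.
move=> xk j; case: eqP => [<-|/eqP ij]; first exact: grade_shift_iter.
rewrite shift0; have := xk j; elim: a => //= a IH xj.
by apply: grade_V; [rewrite eq_sym|exact: IH].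
Qed.

Lemma graded_Vprod k l r x : graded k x ->
  graded (fun i => shift (k i) (total_degree l r i)) (Vprod l r x).
Proof.
move=> xk; elim: r => [|j r IH].
  by rewrite Vprod_nil => i; rewrite /total_degree big_nil shift0.
rewrite Vprod_cons; apply: eq_graded (graded_iterV _ _ IH) => i /=.
rewrite shiftD /total_degree big_cons addnC.
by case: ifP.
Qed.

(** A vector whose grades are at least the exponents can be divided by the
    product, one factor after the other, from the left. *)
Lemma graded_Vprod_ex k l r y :
  graded (fun i => shift (k i) (total_degree l r i)) y ->
  exists2 x, graded k x & y = Vprod l r x.
Proof.
elim: r y => [|j r IH] y yk.
  exists y; last by rewrite Vprod_nil.
  by apply: eq_graded yk => i; rewrite /total_degree big_nil shift0.
have yj : grade (e j) (shift (shift (k (e j)) (total_degree l r (e j))) (l j)) y.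
  by have := yk (e j); rewrite /total_degree big_cons eqxx shiftD addnC.
have [yE y1j] := grade_unshift_iter yj.
have [i|x xk xE] := IH (iter (l j) (Vs (e j)) y).
  have [->//|ij] := eqVneq i (e j).
  have := yk i; rewrite /total_degree big_cons eq_sym (negPf ij).
  by elim: (l j) => //= a IHa yi; apply: grade_Vs => //; exact: IHa.
by exists x => //; rewrite Vprod_cons -xE yE.
Qed.

(** [V t] moves to the right through the product, leaving one twist for each factor
    that it crosses.  The twists commute with the isometries and gather on the
    left, in the order of the factors. *)
Lemma V_Vprod t l r x : (forall j, j \in r -> e j != t) ->
  V t (Vprod l r x) = twist_prod t l predT r (Vprod l r (V t x)).
Proof.
elim: r => [|j r IH] jt; first by rewrite !Vprod_nil /twist_prod big_nil.
have tj : t != e j by rewrite eq_sym jt// mem_head.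
have jt' a : a \in r -> e a != t by move=> ar; apply: jt; rewrite inE ar orbT.
have cT : commutant (twist_prod t l predT r).
  by apply: twist_prod_commutant => a /jt'.
by rewrite !Vprod_cons VV_iter// IH// twist_prod_cons /= (commutant_iterV _ _ _ cT).
Qed.

(** If [V t] is itself one of the factors, it stops there and raises an exponent;
    only the factors to the left of it have been crossed. *)
Lemma V_Vprod_in (i : 'I_m) l l' r x : injective e ->
  pairwise (fun a b : 'I_m => (a < b)%N) r -> i \in r ->
  (forall j, l j = (l' j + (j == i))%N) ->
  V (e i) (Vprod l' r x) =
  twist_prod (e i) l' (fun j => (j < i)%N) r (Vprod l r x).
Proof.
move=> e_inj; elim: r => // j r IH; rewrite pairwise_cons => /andP[/allP jr rs].
rewrite inE twist_prod_cons !Vprod_cons => ir ll'.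
have cT : commutant (twist_prod (e i) l' (fun j => (j < i)%N) r).
  apply: twist_prod_commutant => a _ ai; rewrite (inj_eq e_inj).
  by apply: contraTneq ai => ->; rewrite ltnn.
have [ji|ij] := eqVneq i j.
  rewrite -ji ltnn ll' eqxx addn1 /=.
  have nilT y : twist_prod (e i) l' (fun j => (j < i)%N) r y = y.
    rewrite /twist_prod big_seq_cond big_pred0// => a; apply/negP => /andP[/jr].
    by rewrite -ji ltnNge => /negP + /ltnW.
  rewrite nilT; congr (V _ (iter _ _ _)).
  rewrite /Vprod; congr (_ x); apply: eq_big_seq => a /jr ja.
  rewrite -ji in ja; rewrite ll'; have -> : (a == i) = false by exact: gtn_eqF.
  by rewrite addn0.
move: ir; rewrite (negPf ij) /= => ir.
rewrite (jr _ ir) ll' eq_sym (negPf ij) addn0 VV_iter ?(inj_eq e_inj)//.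
by rewrite IH// (commutant_iterV _ _ _ cT).
Qed.

Lemma Vprod0 l r x : (forall j, l j = 0%N) -> Vprod l r x = x.
Proof.
by move=> l0; elim: r => [|j r IH]; rewrite ?Vprod_nil// Vprod_cons l0.
Qed.

Lemma inner_VprodV l r x y : inner (Vprod l r x) (Vprod l r y) = inner x y.
Proof.
elim: r => [|j r IH]; first by rewrite !Vprod_nil.
by rewrite !Vprod_cons -IH; elim: (l j) => //= b <-; rewrite innerVV.
Qed.

Lemma Vproj_Vprod l r j x : injective e -> j \in r ->
  Vproj (e j) (l j) (Vprod l r x) = Vprod l r x.
Proof.
move=> e_inj; elim: r => // a r IH; rewrite inE Vprod_cons.
have [->|ja /=] := eqVneq j a; first by rewrite /Vproj VsVK.
by move/IH => {2}<-; elim: (l a) => //= b <-; rewrite Vproj_V ?(inj_eq e_inj).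
Qed.

Lemma Vprod_adjoint l r x : exists z, forall y, inner x (Vprod l r y) = inner z y.
Proof.
elim: r x => [|j r IH] x; first by exists x => y; rewrite Vprod_nil.
have [z zP] := IH (iter (l j) (Vs (e j)) x).
by exists z => y; rewrite -zP Vprod_cons inner_iterV.
Qed.

End Products.

(** * Wandering subspaces and coefficients *)

(** Joint grades are orthogonal complements, since the [Vproj i l] are self-adjoint;
    hence they are closed subspaces, and there are orthogonal projections onto
    them. *)
Lemma gradedE (k : 'I_n -> option nat) : graded k =
  orth [set Vproj i.1.1 i.1.2 i.2 - (if below (k i.1.1) i.1.2 then i.2 else 0)
       | i in [set: 'I_n * nat * H]].
Proof.
apply/seteqP; split=> [x xk _ [[[i l] y] _ <-]|x x_orth i l] /=.
  by rewrite innerBr -inner_Vproj xk; case: below; rewrite ?inner0l ?inner0r subrr.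
apply: inner_inj => y; have := x_orth _ (ex_intro2 _ _ (i, l, y) I erefl).
rewrite innerBr -inner_Vproj => /eqP; rewrite subr_eq0 => /eqP ->.
by case: below; rewrite ?inner0l ?inner0r.
Qed.

Lemma graded_lin k a x y : graded k x -> graded k y -> graded k (a *: x + y).
Proof. by rewrite gradedE; exact: orth_lin. Qed.

Lemma graded_projection (k : 'I_n -> option nat) x :
  exists2 z, graded k z & forall y, graded k y -> inner x y = inner z y.
Proof. by rewrite gradedE; exact: orth_projection. Qed.

(** The wandering subspace for [A] is the joint grade of this profile. *)
Definition wandering_profile A i : option nat := if i \in A then Some 0%N else None.

Lemma VpowE A (l : multiindex #|A|) : Vpow V l = Vprod enum_val l (index_enum _).
Proof. by []. Qed.

(** That a vector of the wandering subspace lies in the range of [V_i^a], for [i]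
    outside [A], follows by choosing an exponent [l] with [l i = a].  Conversely, a
    vector in all these ranges can be divided by any product of powers of the
    [V i] with [i] outside [A]: each quotient still has infinite grade for them and
    keeps its grade [0] on [A]. *)
Lemma wandering_graded A : wandering V A = graded (wandering_profile A).
Proof.
apply/seteqP; split=> x.
  move=> xA i; rewrite /wandering_profile; case: ifPn => [iA|].
    (* exponent 0: x itself is annihilated by the adjoints *)
    have [y yA <-] := xA [ffun=> 0%N] I.
    rewrite VpowE Vprod0; first by apply/grade0; exact: yA.
    by move=> j; rewrite ffunE.
  move=> iA' a /=; have iA : i \in ~: A by rewrite inE.
  have [y _ <-] := xA [ffun=> a] I.
  pose j := enum_rank_in iA i.
  have := @Vproj_Vprod _ enum_val [ffun=> a] (index_enum _) j y enum_val_inj (mem_index_enum _).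
  by rewrite ffunE /j enum_rankK_in.
move=> xA l _.
have [|y yA ->] := @graded_Vprod_ex _ enum_val (wandering_profile A) l (index_enum _) x.
  apply: eq_graded xA => i; rewrite /wandering_profile; case: ifP => //= iA.
  rewrite /total_degree big_pred0// => j; apply/negP => /eqP ji.
  by have := enum_valP j; rewrite ji inE iA.
exists y => // i /= iA; apply/grade0; have := yA i.
by rewrite /wandering_profile iA.
Qed.

Section Coefficients.
Variable A : {set 'I_n}.
Implicit Type k : multiindex #|A|.

(** The grades of the vectors [V_A^k y] with [y] in the wandering subspace for
    [A]. *)
Definition profile k i : option nat :=
  shift (wandering_profile A i) (total_degree enum_val k (index_enum _) i).

Lemma profile_enum_val k j : profile k (enum_val j) = Some (k j).
Proof.
rewrite /profile /wandering_profile enum_valP /=; congr Some.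
by rewrite /total_degree (big_pred1 j)// => a; rewrite /= (inj_eq enum_val_inj).
Qed.

Lemma profileN k i : i \notin A -> profile k i = None.
Proof. by rewrite /profile /wandering_profile => /negPf ->. Qed.

Lemma profile_isSome k i : isSome (profile k i) = (i \in A).
Proof. by rewrite /profile /wandering_profile; case: ifP. Qed.

Lemma graded_Vpow k y : wandering V A y -> graded (profile k) (Vpow V k y).
Proof. by rewrite wandering_graded; exact: graded_Vprod. Qed.

Lemma graded_Vpow_ex k x : graded (profile k) x ->
  exists2 y, wandering V A y & x = Vpow V k y.
Proof. by rewrite wandering_graded; exact: graded_Vprod_ex. Qed.

Lemma coefficient_ex k x : exists z, wandering V A z /\
  forall y, wandering V A y -> inner x (Vpow V k y) = inner z y.
Proof.
have [w wP] := Vprod_adjoint enum_val k (index_enum _) x.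
have [z] := graded_projection (wandering_profile A) w.
by rewrite -wandering_graded => zA zP; exists z; split=> // y /zP <-; exact: wP.
Qed.

(** The coefficient of [z^k] in the [A]-component of the model of [x]: the adjoint
    of [V_A^k], seen as an isometry of the wandering subspace into [H], applied to
    [x]. *)
Definition coefficient k x : H :=
  get [set z | wandering V A z /\
    forall y, wandering V A y -> inner x (Vpow V k y) = inner z y].

Lemma coefficient_wandering k x : wandering V A (coefficient k x).
Proof. by have [] := getPex (coefficient_ex k x). Qed.

Lemma inner_coefficient k x y : wandering V A y ->
  inner (coefficient k x) y = inner x (Vpow V k y).
Proof. by have [_ h] := getPex (coefficient_ex k x) => /h. Qed.

Lemma coefficient_unique k x z : wandering V A z ->
  (forall y, wandering V A y -> inner x (Vpow V k y) = inner z y) ->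
  coefficient k x = z.
Proof.
move=> zA zP; have cA := coefficient_wandering k x.
have zc y : wandering V A y -> inner z y = inner (coefficient k x) y.
  by move=> yA; rewrite -zP// inner_coefficient.
have zz : inner z z = inner (coefficient k x) (coefficient k x).
  by rewrite zc// innerC zc// -innerC.
by apply/esym/inner_eq; rewrite zz// zc.
Qed.

Lemma coefficient_lin k a x y :
  coefficient k (a *: x + y) = a *: coefficient k x + coefficient k y.
Proof.
apply: coefficient_unique => [|z zA].
  by rewrite wandering_graded; apply: graded_lin; rewrite -wandering_graded;
    exact: coefficient_wandering.
by rewrite !innerDl !innerZl !inner_coefficient.
Qed.

End Coefficients.

(** Joint grades are indexed by pairs [(A, k)]: [A] consists of the indices of
    finite grade, [k] of the values of these grades. *)
Lemma profile_surj (k : 'I_n -> option nat) :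
  exists A (l : multiindex #|A|), k =1 profile l.
Proof.
exists [set i | k i]%SET, [ffun j => odflt 0%N (k (enum_val j))] => i.
have [iA|iA] := boolP (i \in [set i | k i]%SET).
  rewrite -(enum_rankK_in iA iA) profile_enum_val ffunE enum_rankK_in//.
  by move: iA; rewrite inE; case: (k i).
by rewrite profileN//; move: iA; rewrite inE; case: (k i).
Qed.

Lemma Vpow_orth A (k k' : multiindex #|A|) x y : k != k' ->
  wandering V A x -> wandering V A y -> inner (Vpow V k x) (Vpow V k' y) = 0.
Proof.
move=> kk' xA yA; have [j kj] : exists j, k j != k' j.
  by apply/existsP; apply: contraNT kk' => /existsPn h; apply/eqP/ffunP => j; apply/eqP/negPn.
have kj' : profile k (enum_val j) != profile k' (enum_val j).
  by rewrite !profile_enum_val; apply: contraNneq kj => -[->].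
by apply: (grade_orth kj'); exact: graded_Vpow.
Qed.

Lemma Vpow_orth_set A A' (k : multiindex #|A|) (k' : multiindex #|A'|) x y :
  A != A' -> wandering V A x -> wandering V A' y ->
  inner (Vpow V k x) (Vpow V k' y) = 0.
Proof.
move=> AA' xA yA; have [i iAA'] : exists i, (i \in A) != (i \in A').
  by apply/existsP; apply: contraNT AA' => /existsPn h; apply/eqP/setP => i; apply/eqP/negPn.
have ki : profile k i != profile k' i.
  by apply: contraNneq iAA' => h; rewrite -(profile_isSome k) -(profile_isSome k') h.
by apply: (grade_orth ki); exact: graded_Vpow.
Qed.

Lemma coefficient_total x y :
  (forall A (k : multiindex #|A|), coefficient k x = coefficient k y) -> x = y.
Proof.
move=> xy; apply/eqP; rewrite -subr_eq0; apply/eqP/graded_total => k z zk.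
have [A [l kl]] := profile_surj k.
have [w wA ->] := graded_Vpow_ex (eq_graded kl zk).
by rewrite innerBl -!inner_coefficient// xy subrr.
Qed.

(** * The model operators *)

Lemma graded_commutant T (k : 'I_n -> option nat) x :
  commutant T -> graded k (T x) <-> graded k x.
Proof.
by move=> cT; split=> xk i; have := xk i; rewrite grade_commutant.
Qed.

Lemma wandering_preimage T A y : commutant T -> wandering V A y ->
  exists2 x, wandering V A x & y = T x.
Proof.
move=> cT; have [[_ /(_ y)[x <-]] _ _] := cT.
by rewrite wandering_graded graded_commutant// => xA; exists x.
Qed.

Lemma wandering_commutant T A x : commutant T -> wandering V A x -> wandering V A (T x).
Proof. by move=> cT; rewrite wandering_graded graded_commutant. Qed.

Lemma wandering_V A t x : t \notin A -> wandering V A x -> wandering V A (V t x).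
Proof.
move=> tA; rewrite wandering_graded => xA i.
have [->|it] := eqVneq i t; last by apply: grade_V.
by have := grade_shift (xA t); rewrite /wandering_profile (negPf tA).
Qed.

Lemma wandering_Vs A t x : t \notin A -> wandering V A x ->
  V t (Vs t x) = x /\ wandering V A (Vs t x).
Proof.
move=> tA; rewrite wandering_graded => xA.
have [|VVs Vsx] := @grade_unshift t None x.
  by have := xA t; rewrite /wandering_profile (negPf tA).
split=> // i; have [->|it] := eqVneq i t; last exact: grade_Vs.
by rewrite /wandering_profile (negPf tA).
Qed.

Lemma wandering0 A : wandering V A 0.
Proof.
by rewrite wandering_graded => i l; rewrite Vproj_0; case: below.
Qed.

Lemma commutant_Vpow T A (k : multiindex #|A|) x :
  commutant T -> T (Vpow V k x) = Vpow V k (T x).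
Proof.
move=> cT; rewrite VpowE; elim: (index_enum _) => [|j r IH].
  by rewrite !Vprod_nil.
by rewrite !Vprod_cons (commutant_iterV _ _ _ cT) IH.
Qed.

Lemma diagop_prod m (T : 'I_m -> H -> H) (P : pred 'I_m) (r : seq 'I_m)
    (f : pseries H m) k :
  (\big[comp/id]_(j <- r | P j) diagop j (T j)) f k =
  (\big[comp/id]_(j <- r | P j) iter (k j) (T j)) (f k).
Proof.
elim: r => [|j r IH]; first by rewrite !big_nil.
by rewrite !big_cons; case: ifP => // _; rewrite /= /diagop IH.
Qed.

Lemma index_enum_pairwise m : pairwise (fun a b : 'I_m => (a < b)%N) (index_enum 'I_m).
Proof.
have : pairwise ltn (map val (enum 'I_m)).
  by rewrite val_enum_ord -sorted_pairwise ?iota_ltn_sorted//; exact: ltn_trans.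
by rewrite pairwise_map enumT /index_enum; case: index_enum_key.
Qed.

(** The intertwining relation, one coefficient at a time.  Moving [V t] into
    [V_A^k] produces a product [T] of twists, which is also the product of the
    diagonal operators in the model operator.  Identities between coefficients are
    tested on vectors [T y] with [y] in the wandering subspace: these are all its
    vectors, and the unitary [T] cancels in the inner products. *)
Lemma coefficient_V A (k : multiindex #|A|) t x :
  coefficient k (V t x) = model_op U V t (fun k => coefficient k x) k.
Proof.
rewrite /model_op; case: pickP => [i /eqP it|tA].
  rewrite /mulz /=; have [ki|ki] := eqVneq (k i) 0%N.
    apply: coefficient_unique => [|y yA]; first exact: wandering0.
    (* V_A^k y is in the kernel of the adjoint of V t *)
    have /grade0 Vsy : grade t (Some 0%N) (Vpow V k y).
      by rewrite -ki -(profile_enum_val k i) it; exact: graded_Vpow.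
    by rewrite innerV Vsy inner0r inner0l.
  (* k' is k with the i-th exponent lowered by one. *)
  set k' := [ffun j => _]; rewrite diagop_prod.
  pose T := twist_prod enum_val t k' (fun j => (j < i)%N) (index_enum _).
  have cT : commutant T.
    apply: twist_prod_commutant => j _ ji; rewrite -it (inj_eq enum_val_inj).
    by apply: contraTneq ji => ->; rewrite ltnn.
  have VT y : V t (Vpow V k' y) = T (Vpow V k y).
    rewrite /T -it; apply: V_Vprod_in => //.
    - exact: enum_val_inj.
    - exact: index_enum_pairwise.
    - exact: mem_index_enum.
    - move=> j; rewrite ffunE; case: eqP => [->|_]; last by rewrite subn0 addn0.
      by rewrite subnK// lt0n.
  rewrite -[X in _ = X]/(T (coefficient k' x)).
  apply: coefficient_unique; first exact/wandering_commutant/coefficient_wandering.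
  move=> _ /(wandering_preimage cT)[y yA ->].
  by rewrite -commutant_Vpow// -VT innerVV; case: cT => -[-> _ _ _]; rewrite inner_coefficient.
have {}tA : t \notin A.
  apply/negP => tA'; have := tA (enum_rank_in tA' t).
  by rewrite enum_rankK_in// eqxx.
rewrite /= diagop_prod /tensop.
pose T := twist_prod enum_val t k predT (index_enum _).
have At (j : 'I_#|A|) : enum_val j != t.
  by apply: contraNneq tA => <-; exact: enum_valP.
have cT : commutant T by apply: twist_prod_commutant.
rewrite -[X in _ = X]/(T (V t (coefficient k x))).
apply: coefficient_unique.
  by apply/wandering_commutant/wandering_V => //; exact: coefficient_wandering.
move=> _ /(wandering_preimage cT)[y yA ->].
(* outside A, V t is invertible on the wandering subspace *)
have [yE wA] := wandering_Vs tA yA; rewrite -yE.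
rewrite -commutant_Vpow// -[X in inner _ X]V_Vprod// innerVV.
by case: cT => -[-> _ _ _]; rewrite innerVV inner_coefficient.
Qed.

End Twisted.

(** * Unconditional sums of orthogonal families *)

#[local] Existing Instance summability.totally_filter.

Section Sums.
Variables (R : realType) (H : hilbertType R) (I : choiceType).
Implicit Types (J : {fset I}) (e : I -> H).

Lemma summable_bounded (f : I -> R) : (forall i, 0 <= f i) ->
  summable setT (fun i => (f i)%:E) <->
  exists M, forall J, \sum_(i <- J) f i <= M.
Proof.
move=> f0.
have sumE (X : set I) : finite_set X ->
    (\sum_(i \in X) `|(f i)%:E|)%E = (\sum_(i <- fset_set X) f i)%:E.
  move=> finX; rewrite fsbig_finite//= -sumEFin.
  by apply: eq_bigr => i _; rewrite ger0_norm.
split=> [|[M fM]].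
  move=> sf; exists (fine (\esum_(i in setT) `|(f i)%:E|)%E) => J.
  rewrite -lee_fin fineK; last by rewrite -summableE.
  apply: ereal_sup_ubound; exists [set` J]; first by split.
  by rewrite sumE// set_fsetK.
rewrite /summable; apply: (@le_lt_trans _ _ M%:E); last exact: ltry.
apply: ge_ereal_sup => _ [X [finX _] <-]; rewrite sumE// lee_fin; exact: fM.
Qed.

Lemma sqnorm_sum e (r : seq I) : uniq r ->
  (forall i j, i != j -> inner (e i) (e j) = 0) ->
  sqnorm (\sum_(i <- r) e i) = \sum_(i <- r) sqnorm (e i).
Proof.
move=> + e_orth; elim: r => [|i r IH /= /andP[ir /IH r_sum]].
  by rewrite !big_nil /sqnorm inner0l.
rewrite !big_cons sqnormD r_sum inner_sumr [X in complex.Re X]big1_seq ?mulr0 ?addr0// => j /= jr.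
by apply: e_orth; apply: contraNneq ir => ->.
Qed.

Lemma big_fset_subD (W : zmodType) (F : I -> W) J0 J : (J0 `<=` J)%fset ->
  \sum_(i <- J) F i - \sum_(i <- J0) F i = \sum_(i <- (J `\` J0)%fset) F i.
Proof.
move=> J0J; apply/eqP; rewrite subr_eq addrC -big_cat; apply/eqP/perm_big.
apply: uniq_perm; rewrite ?fset_uniq// ?cat_uniq ?fset_uniq/= ?andbT.
  by apply/hasPn => i; rewrite inE => /andP[].
by move=> i; rewrite mem_cat inE; have [/(fsubsetP J0J)->|] := boolP (i \in J0).
Qed.

Lemma partial_sumE (K : numDomainType) (W : normedModType K) (F : I -> W) J :
  summability.partial_sum F J = \sum_(i <- J) F i.
Proof. by rewrite /summability.partial_sum big_seq_fsetE. Qed.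

(** A finite set [J0] whose sum of squared norms is nearly maximal leaves little
    for any set disjoint from it, so by orthogonality the finite sums over sets
    containing [J0] are close to each other. *)
Lemma orthogonal_sum_cvg e M : (forall i j, i != j -> inner (e i) (e j) = 0) ->
  (forall J, \sum_(i <- J) sqnorm (e i) <= M) ->
  cvg (summability.partial_sum e @ summability.totally).
Proof.
move=> e_orth eM; pose q J := \sum_(i <- J) sqnorm (e i).
have supq : has_sup (range q).
  by split; [exists (q fset0), fset0|exists M => _ [J _ <-]; exact: eM].
apply: sqnorm_cauchy_cvg => r r0.
have r4 : 0 < r / 4 by rewrite divr_gt0.
have [_ [J0 _ <-] J0sup] := sup_adherent r4 supq.
exists [set J | (J0 `<=` J)%fset]; first by exists J0.
have close J : (J0 `<=` J)%fset ->
    sqnorm (summability.partial_sum e J - summability.partial_sum e J0) < r / 4.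
  move=> J0J; rewrite !partial_sumE big_fset_subD//.
  rewrite sqnorm_sum// -big_fset_subD//.
  have : q J <= sup (range q) by apply: ub_le_sup; [exact: supq.2|exists J].
  by rewrite -/(q J) -/(q J0); lra.
move=> J J' /close cJ /close cJ'.
have := sqnormD_le (summability.partial_sum e J - summability.partial_sum e J0)
  (summability.partial_sum e J0 - summability.partial_sum e J').
rewrite addrA subrK (sqnormBC (summability.partial_sum e J0)); lra.
Qed.

End Sums.

(** * The unitary onto the model *)

Section Model.
Variables (R : realType) (H : hilbertType R) (n : nat).
Variables (U : 'I_n -> 'I_n -> {linear H -> H}) (V : 'I_n -> {linear H -> H}).
Hypothesis twV : twisted_isometry U V.
Implicit Types (x y z : H) (A : {set 'I_n}) (F : model_family H n).

Let coef x : model_family H n := fun A k => coefficient V k x.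

Lemma sqnorm_Vpow A (k : multiindex #|A|) x : sqnorm (Vpow V k x) = sqnorm x.
Proof. by rewrite /sqnorm VpowE (inner_VprodV twV). Qed.

(** The finite sum [w] is an orthogonal projection of [x], hence at most as long. *)
Lemma bessel A x (J : {fset multiindex #|A|}) :
  \sum_(k <- J) sqnorm (coefficient V k x) <= sqnorm x.
Proof.
pose w := \sum_(k <- J) Vpow V k (coefficient V k x).
have w_sqnorm : sqnorm w = \sum_(k <- J) sqnorm (coefficient V k x).
  rewrite sqnorm_sum//; first by apply: eq_bigr => k _; rewrite sqnorm_Vpow.
  by move=> k k' kk'; apply: (Vpow_orth twV) => //; exact: (coefficient_wandering twV).
have xw : inner x w = (sqnorm w)%:C%C.
  rewrite inner_sumr w_sqnorm rmorph_sum; apply: eq_bigr => k _.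
  rewrite -(inner_coefficient twV); last exact: (coefficient_wandering twV).
  exact: inner_sqnorm.
have := sqnorm_ge0 (x - w); rewrite sqnormB xw /= -w_sqnorm; lra.
Qed.

Lemma coefficient_hardy A x : hardy (wandering V A) (coef x (A := A)).
Proof.
split=> [k|]; first exact: (coefficient_wandering twV).
have sE : (fun k : multiindex #|A| => ((complex.Re `|coef x k|) ^+ 2)%:E) =
          (fun k => (sqnorm (coef x k))%:E).
  by apply/funext => k; rewrite sqnormE.
rewrite sE; apply/summable_bounded => [k|]; first exact: sqnorm_ge0.
by exists (sqnorm x); exact: bessel.
Qed.

(** The series of the [V_A^k (f k)] is orthogonal and its terms have the norms of
    the [f k], so it converges.  Its sum is described by inner products because
    these are what the inner product of the model sums up. *)
Lemma hardy_synthesis A (f : pseries H #|A|) : hardy (wandering V A) f ->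
  exists s, forall y,
    (summability.partial_sum (fun k => inner (Vpow V k (f k)) y : R[i]^o)
      @ summability.totally) --> (inner s y : R[i]^o).
Proof.
move=> [fA]; have sE : (fun k : multiindex #|A| => ((complex.Re `|f k|) ^+ 2)%:E) =
          (fun k => (sqnorm (f k))%:E).
  by apply/funext => k; rewrite sqnormE.
rewrite sE => /summable_bounded[k|M fM]; first exact: sqnorm_ge0.
have : cvg (summability.partial_sum (fun k => Vpow V k (f k)) @ summability.totally).
  apply: (@orthogonal_sum_cvg _ _ _ _ M) => [k k' kk'|J].
    by apply: (Vpow_orth twV).
  by under eq_bigr do rewrite sqnorm_Vpow.
move=> /cvg_ex[s s_lim]; exists s => y.
rewrite (_ : summability.partial_sum _ =
  fun J => inner (summability.partial_sum (fun k => Vpow V k (f k)) J) y).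
  exact: inner_cvg.
by apply/funext => J; rewrite !partial_sumE inner_suml.
Qed.

(** Every element [F] of the model is the family of coefficients of the sum [s] of
    all the [V_A^k (F A k)], because these vectors are orthogonal for distinct
    [(A, k)].  Since [inner (F A k) (coefficient V k y)] and
    [inner (V_A^k (F A k)) y] agree, the same sum computes the inner product of the
    model. *)
Lemma model_synthesis F : model_space V F ->
  exists2 s, coef s = F & forall y, model_inner F (coef y) = inner s y.
Proof.
move=> Fhardy.
have /choice[s sP] : forall A, exists s, forall y,
    (summability.partial_sum (fun k => inner (Vpow V k (F A k)) y : R[i]^o)
      @ summability.totally) --> (inner s y : R[i]^o).
  by move=> A; exact: hardy_synthesis (Fhardy A).
have FA A k : wandering V A (F A k) by have [] := Fhardy A.
exists (\sum_A s A).
  apply: functional_extensionality_dep => A; apply/funext => k.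
  apply: (coefficient_unique twV) => [|y yA]; first exact: FA.
  rewrite inner_suml (bigD1 A)//= big1 ?addr0 => [|A' A'A].
    apply: (limC_unique (sP A _)); apply: cvg_near_cst.
    (* only the term of index k contributes to the partial sums *)
    exists [fset k]%fset => // J kJ.
    rewrite partial_sumE (bigD1_seq k) ?fset_uniq//=; last first.
      by apply: (fsubsetP kJ); rewrite inE.
    rewrite VpowE (inner_VprodV twV) big1 ?addr0// => k' k'k.
    exact: (Vpow_orth twV).
  apply: (limC_unique (sP A' _)); apply: cvg_near_cst.
  apply: nearW => J; rewrite partial_sumE big1// => k' _.
  exact: (Vpow_orth_set twV).
move=> y; rewrite inner_suml; apply: eq_bigr => A _.
rewrite /hardy_inner /summability.sum.
have -> : (fun k => inner (F A k) (coef y k) : R[i]^o) =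
          (fun k => inner (Vpow V k (F A k)) y : R[i]^o).
  by apply/funext => k; rewrite innerC (inner_coefficient twV)// -innerC.
by apply: (@cvg_lim R[i]^o (@norm_hausdorff _ _)); exact: sP.
Qed.

End Model.

Theorem theorem4p4 (R : realType) (H : hilbertType R) (sepH : separable H)
    (n : nat) (n_ge2 : (2 <= n)%N)
    (U : 'I_n -> 'I_n -> {linear H -> H}) (V : 'I_n -> {linear H -> H}) :
  twisted_isometry U V ->
  exists Pi : H -> model_family H n,
    unitary_onto_model V Pi /\
    forall (i : 'I_n) (x : H), Pi (V i x) = model_sum_op U V i (Pi x).
Proof.
move=> twV; pose Pi x : model_family H n := fun A k => coefficient V k x.
have Pi_space x : model_space V (Pi x) by move=> A; exact: (coefficient_hardy twV).
exists Pi; split; last first.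
  move=> i x; apply: functional_extensionality_dep => A; apply/funext => k.
  exact: (coefficient_V twV).
split.
- by move=> a x y A k; exact: (coefficient_lin twV).
- move=> x y; have [s sx sP] := model_synthesis twV (Pi_space x).
  rewrite sP.
  (* x and the sum of its series have the same coefficients *)
  suff -> : x = s by [].
  apply: (coefficient_total twV) => A k.
  exact: esym (congr1 (fun F : model_family H n => F A k) sx).
- apply/seteqP; split=> [_ [x _ <-]//|F FV].
  by have [s sF _] := model_synthesis twV FV; exists s.
Qed.
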